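(* Let $n\ge 0$ be a fixed integer, let $\phi\in\mathbb{R}$ be fixed, and write $x+i\lambda=re^{i\theta}$ with $r\ge 0$, $\theta\in[0,\pi]$ (so $x=r\cos\theta$, $\lambda=r\sin\theta$). Put $$A=2\left[x(\sin\phi-\sin2\phi)+\lambda(\cos\phi-\cos2\phi)\right],$$ $$C=2\left[x(2\sin\phi-\sin2\phi)+\lambda(2\cos\phi-\cos2\phi)\right]-1 .$$ Then $$P_n^{(\lambda)}(x;\phi)=L_n^{(C)}(A)+\mathcal{O}\left(r^{n-2}\right),\qquad r\to\infty,$$ uniformly with respect to $\theta\in[0,\pi]$.
   Context: The Meixner-Pollaczek polynomials $P_n^{(\lambda)}(x;\phi)$ are defined by the generating function $$\left(1-e^{i\phi}w\right)^{-\lambda+ix}\left(1-e^{-i\phi}w\right)^{-\lambda-ix}=\sum_{n=0}^\infty P_n^{(\lambda)}(x;\phi)\,w^n,\qquad |w|<1,$$ with powers taking the value $1$ at $w=0$. The Laguerre polynomials $L_n^{(\alpha)}(x)$ are defined, for $\alpha,x\in\mathbb{C}$, by $$(1-w)^{-\alpha-1}e^{-wx/(1-w)}=\sum_{n=0}^\infty L_n^{(\alpha)}(x)\,w^n,\qquad |w|<1.$$ *)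

(* Defs.v *)
From Stdlib Require Import Reals ZArith.
From Coquelicot Require Import Coquelicot.
Open Scope R_scope.

Definition Cexp (z : C) : C :=
  (exp (Re z) * cos (Im z), exp (Re z) * sin (Im z)).

(* Principal logarithm, meaningful only on the half-plane [0 < Re z].  The bases
   used below, [1 - u * w] with [Cmod u = 1] and [Cmod w < 1], all lie there. *)
Definition Cln (z : C) : C := (ln (Cmod z), atan (Im z / Re z)).

(* Holomorphic branch of [z ^ s] on [0 < Re z] with value 1 at [z = 1],
   hence with value 1 at [w = 0] for the bases [1 - u * w]. *)
Definition Cpower (z s : C) : C := Cexp (s * Cln z)%C.

Definition MP_gen (lambda x phi : R) (w : C) : C :=
  (Cpower (1 - Cexp (Ci * phi) * w) (- lambda + Ci * x) *
   Cpower (1 - Cexp (- (Ci * phi)) * w) (- lambda - Ci * x))%C.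

(* [P n lambda x phi] stands for P_n^(lambda)(x; phi). *)
Definition is_Meixner_Pollaczek (P : nat -> R -> R -> R -> C) : Prop :=
  forall (lambda x phi : R) (w : C), Cmod w < 1 ->
    is_pseries (fun n => P n lambda x phi) w (MP_gen lambda x phi w).

Definition Laguerre_gen (alpha x w : C) : C :=
  (Cpower (1 - w) (- alpha - 1) * Cexp (- (w * x) / (1 - w)))%C.

(* [L n alpha x] stands for L_n^(alpha)(x). *)
Definition is_Laguerre (L : nat -> C -> C -> C) : Prop :=
  forall alpha x w : C, Cmod w < 1 ->
    is_pseries (fun n => L n alpha x) w (Laguerre_gen alpha x w).

Definition coefA (phi x lambda : R) : R :=
  2 * (x * (sin phi - sin (2 * phi)) + lambda * (cos phi - cos (2 * phi))).

Definition coefC (phi x lambda : R) : R :=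
  2 * (x * (2 * sin phi - sin (2 * phi)) + lambda * (2 * cos phi - cos (2 * phi))) - 1.

(* Main.v *)
Require Import Defs.
From Stdlib Require Import Reals ZArith Lra Lia.
From Coquelicot Require Import Coquelicot.
Open Scope R_scope.

(** For real [w] both generating functions have the form
    [exp (sum_{k >= 1} b_k w^k / k)] with real [b_k = O(r)]: for the
    Meixner-Pollaczek polynomials [b_k = 2 (lambda cos (k phi) + x sin (k phi))],
    for the Laguerre polynomials [b_k = C + 1 - k A].  The parameters [A] and [C]
    are chosen so that the two sequences agree at [k = 1] and [k = 2].
    Differentiating in [w] gives [n f_n = sum_{k=1}^n b_k f_{n-k}], from which
    [f_n = O(r^n)], and the difference of the two solutions first feels a
    discrepancy of size [O(r)] at index 3, hence is [O(r^{n-2})].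
    The convolution recurrence is obtained without summing the logarithm: in
    both cases [sum_k b_{k+1} w^k] is a rational function with denominator
    [1 - 2 c w + w^2] ([c = cos phi], resp. [c = 1]), so the generating function
    solves a first-order equation with polynomial coefficients. *)

(** * Real and imaginary parts of power series, uniqueness of coefficients *)

Lemma is_series_Re_Im (a : nat -> C) (l : C) :
  is_series (V := C_NormedModule) a l ->
  is_series (fun n => Re (a n)) (Re l) /\ is_series (fun n => Im (a n)) (Im l).
Proof.
  intros H.
  assert (Hsum : forall n, sum_n (G := C_AbelianMonoid) a n
            = (sum_n (fun k => Re (a k)) n, sum_n (fun k => Im (a k)) n)).
  { induction n as [|n IHn].
    - rewrite !sum_O. now destruct (a 0%nat).
    - rewrite !sum_Sn, IHn. reflexivity. }
  split; intros Q [eps He];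
    destruct (H _ (locally_ball (l : C_UniformSpace) eps)) as [N HN];
    exists N; intros n Hn; apply He; specialize (HN n Hn);
    rewrite Hsum in HN; apply HN.
Qed.

Lemma C_pow_n_RtoC (t : R) (n : nat) :
  pow_n (K := C_Ring) (RtoC t) n = RtoC (pow_n t n).
Proof.
  induction n as [|n IHn]; [reflexivity|].
  simpl. rewrite IHn. symmetry. apply RtoC_mult.
Qed.

Lemma is_pseries_Re_Im (a : nat -> C) (t : R) (l : C) :
  is_pseries (K := C_AbsRing) (V := C_NormedModule) a (RtoC t) l ->
  is_pseries (fun n => Re (a n)) t (Re l) /\ is_pseries (fun n => Im (a n)) t (Im l).
Proof.
  intros H.
  assert (Hscal : forall n, scal (V := C_NormedModule) (pow_n (RtoC t) n) (a n)
            = (pow_n t n * Re (a n), pow_n t n * Im (a n))).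
  { intros n. change (Cmult (pow_n (K := C_Ring) (RtoC t) n) (a n)
      = (pow_n t n * Re (a n), pow_n t n * Im (a n))).
    rewrite C_pow_n_RtoC. unfold Cmult, Re, Im; simpl. f_equal; ring. }
  apply (is_series_ext _ _ _ Hscal), is_series_Re_Im in H. exact H.
Qed.

(** Convergence at a point [s] strictly between [Rabs t] and 1 puts [s] within the closed disk of
    convergence: beyond the radius the terms could not tend to 0. *)
Lemma CV_radius_gt_of_unit_disk (a : nat -> R) (t : R) :
  (forall s, Rabs s < 1 -> ex_pseries a s) ->
  Rabs t < 1 -> Rbar_lt (Rabs t) (CV_radius a).
Proof.
  intros H Ht. set (s := (1 + Rabs t) / 2).
  assert (Hp := Rabs_pos t).
  assert (Hs : Rabs s = s) by (apply Rabs_pos_eq; unfold s; lra).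
  apply Rbar_lt_le_trans with (Finite s); [simpl; unfold s; lra|].
  rewrite <- Hs. apply Rbar_not_lt_le. intros Hout.
  apply CV_disk_outside in Hout. apply Hout.
  apply is_lim_seq_ext with (fun n => scal (pow_n s n) (a n)).
  { intros n. rewrite pow_n_pow. apply Rmult_comm. }
  apply ex_series_lim_0, H. rewrite Hs; unfold s; lra.
Qed.

Lemma is_pseries_coef_unique (a b : nat -> R) (l : R -> R) :
  (forall t, Rabs t < 1 -> is_pseries a t (l t)) ->
  (forall t, Rabs t < 1 -> is_pseries b t (l t)) ->
  forall n, a n = b n.
Proof.
  intros Ha Hb n.
  assert (H0 : Rabs 0 < 1) by (rewrite Rabs_R0; lra).
  apply PSeries_ext_recip.
  - rewrite <- Rabs_R0. apply CV_radius_gt_of_unit_disk; [|exact H0].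
    intros s Hs; eexists; apply Ha, Hs.
  - rewrite <- Rabs_R0. apply CV_radius_gt_of_unit_disk; [|exact H0].
    intros s Hs; eexists; apply Hb, Hs.
  - exists (mkposreal 1 Rlt_0_1). intros t Ht.
    assert (Ht' : Rabs t < 1).
    { replace t with (t - 0) by ring. exact Ht. }
    rewrite (is_pseries_unique _ _ _ (Ha t Ht')).
    now rewrite (is_pseries_unique _ _ _ (Hb t Ht')).
Qed.

(** * From a first-order differential equation to the convolution recurrence *)

(* The coefficient relation equivalent to
   [sum f_n w^n = f_0 exp (sum_{k >= 1} b_k w^k / k)]; [b 0] plays no role. *)
Definition log_recurrence (b f : nat -> R) : Prop :=
  forall n, INR (S n) * f (S n) = sum_f_R0 (fun k => b (S k) * f (n - k)%nat) n.

(* [E n] is the defect in the convolution recurrence; the two three-term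
   relations combine to [E (n+2) - 2 c E (n+1) + E n = 0]. *)
Lemma log_recurrence_of_three_term (b f : nat -> R) (c : R) :
  (forall k, b (S (S (S k))) - 2 * c * b (S (S k)) + b (S k) = 0) ->
  f 1%nat = b 1%nat * f 0%nat ->
  2 * f 2%nat - 2 * c * f 1%nat
    = b 1%nat * f 1%nat + (b 2%nat - 2 * c * b 1%nat) * f 0%nat ->
  (forall n, INR (S (S (S n))) * f (S (S (S n)))
       - 2 * c * (INR (S (S n)) * f (S (S n))) + INR (S n) * f (S n)
     = b 1%nat * f (S (S n)) + (b 2%nat - 2 * c * b 1%nat) * f (S n)) ->
  log_recurrence b f.
Proof.
  intros Hb H0 H1 H2.
  set (conv := fun n => sum_f_R0 (fun k => b (S k) * f (n - k)%nat) n).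
  assert (Hconv1 : forall n, conv (S n) = b 1%nat * f (S n)
            + sum_f_R0 (fun k => b (S (S k)) * f (n - k)%nat) n).
  { intros n. unfold conv. rewrite decomp_sum by lia. reflexivity. }
  assert (Hconv2 : forall n, conv (S (S n)) = b 1%nat * f (S (S n))
            + b 2%nat * f (S n)
            + sum_f_R0 (fun k => b (S (S (S k))) * f (n - k)%nat) n).
  { intros n. rewrite Hconv1, decomp_sum by lia. simpl; ring. }
  (* The three-term relation for [b] turns the twice shifted convolution into earlier ones. *)
  assert (Hsum : forall n,
     sum_f_R0 (fun k => b (S (S (S k))) * f (n - k)%nat) n
     = 2 * c * sum_f_R0 (fun k => b (S (S k)) * f (n - k)%nat) n - conv n).
  { intros n. unfold conv. rewrite scal_sum, <- minus_sum.
    apply sum_eq. intros k _.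
    replace (b (S (S (S k)))) with (2 * c * b (S (S k)) - b (S k))
      by (specialize (Hb k); lra). ring. }
  (* Two consecutive identities are carried because the relation between defects has order two. *)
  assert (HE : forall n, INR (S n) * f (S n) = conv n
                /\ INR (S (S n)) * f (S (S n)) = conv (S n)).
  { induction n as [|n [IH1 IH2]].
    - split; [unfold conv; simpl; lra|].
      assert (Hc := f_equal (Rmult (2 * c)) H0).
      rewrite Hconv1. simpl. lra.
    - split; [exact IH2|].
      rewrite Hconv2, Hsum, <- IH1.
      rewrite Hconv1 in IH2. specialize (H2 n).
      apply (f_equal (Rmult (2 * c))) in IH2. lra. }
  intros n. apply HE.
Qed.

(** With [F = exp G], the hypothesis on [g] reads [(1 - 2 c t + t^2) F' = (b_1 + q t) F]. Comparing
    Taylor coefficients gives a three-term relation for [f]. *)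
Lemma log_recurrence_of_ode (f : nat -> R) (G : R -> R) (c : R) (b : nat -> R) :
  (forall t, Rabs t < 1 -> is_pseries f t (exp (G t))) ->
  (forall t, Rabs t < 1 -> exists g, is_derive G t g /\
     (1 - 2 * c * t + t * t) * g = b 1%nat + (b 2%nat - 2 * c * b 1%nat) * t) ->
  (forall k, b (S (S (S k))) - 2 * c * b (S (S k)) + b (S k) = 0) ->
  log_recurrence b f.
Proof.
  intros Hf HG Hb. set (q := b 2%nat - 2 * c * b 1%nat) in *.
  set (u := PS_derive f).
  assert (Hu : forall t g, Rabs t < 1 -> is_derive G t g ->
                 is_pseries u t (g * exp (G t))).
  { intros t g Ht Hg.
    assert (Hr : Rbar_lt (Rabs t) (CV_radius f)).
    { apply CV_radius_gt_of_unit_disk; [|exact Ht].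
      intros s Hs; eexists; apply Hf, Hs. }
    replace (g * exp (G t)) with (Derive (PSeries f) t).
    { apply is_pseries_derive, Hr. }
    apply is_derive_unique.
    apply is_derive_ext_loc with (fun s => exp (G s)).
    - assert (Hd : 0 < 1 - Rabs t) by lra.
      exists (mkposreal _ Hd). intros s Hs. symmetry. apply is_pseries_unique, Hf.
      assert (Hs' : Rabs (s - t) < 1 - Rabs t) by exact Hs.
      replace s with ((s - t) + t) by ring.
      pose proof (Rabs_triang (s - t) t). lra.
    - apply (is_derive_comp exp G t (exp (G t)) g); [|exact Hg].
      apply is_derive_Reals, derivable_pt_lim_exp. }
  (* Coefficients of the two sides of the differential equation; each [PS_incr_1] is a
     multiplication by [t]. *)
  set (lhs := PS_plus (PS_plus u (PS_scal (-2 * c) (PS_incr_1 u)))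
                (PS_incr_1 (PS_incr_1 u))).
  set (rhs := PS_plus (PS_scal (b 1%nat) f) (PS_scal q (PS_incr_1 f))).
  assert (Heq : forall n, lhs n = rhs n).
  { apply is_pseries_coef_unique with
      (fun t => (b 1%nat + q * t) * exp (G t)).
    - intros t Ht. destruct (HG t Ht) as [g [Hg Hode]].
      specialize (Hu t g Ht Hg). rewrite <- Hode.
      pose proof (is_pseries_incr_1 _ _ _ Hu) as Hu1.
      pose proof (is_pseries_incr_1 _ _ _ Hu1) as Hu2.
      pose proof (is_pseries_scal (-2 * c) _ _ _ (Rmult_comm _ _) Hu1) as Hu1'.
      pose proof (is_pseries_plus _ _ _ _ _
        (is_pseries_plus _ _ _ _ _ Hu Hu1') Hu2) as H.
      match type of H with is_pseries _ _ ?l =>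
        replace ((1 - 2 * c * t + t * t) * g * exp (G t)) with l end.
      + exact H.
      + cbv [plus scal mult]; simpl; cbv [mult]; simpl; ring.
    - intros t Ht. specialize (Hf t Ht).
      pose proof (is_pseries_scal (b 1%nat) _ _ _ (Rmult_comm _ _) Hf) as H1.
      pose proof (is_pseries_scal q _ _ _ (Rmult_comm _ _)
                    (is_pseries_incr_1 _ _ _ Hf)) as H2.
      pose proof (is_pseries_plus _ _ _ _ _ H1 H2) as H.
      match type of H with is_pseries _ _ ?l =>
        replace ((b 1%nat + q * t) * exp (G t)) with l end.
      + exact H.
      + cbv [plus scal mult]; simpl; cbv [mult]; simpl; ring. }
  assert (Hshift : forall a : nat -> R, PS_incr_1 a 0%nat = 0) by reflexivity.
  assert (HshiftS : forall (a : nat -> R) n, PS_incr_1 a (S n) = a n) by reflexivity.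
  assert (Heq' : forall n,
     u n + -2 * c * PS_incr_1 u n + PS_incr_1 (PS_incr_1 u) n
     = b 1%nat * f n + q * PS_incr_1 f n) by exact Heq.
  (* Coefficients 0 and 1 give the initial relations, since the shifted series start with zeros;
     coefficient [n + 2] is the generic case. *)
  apply log_recurrence_of_three_term with c; [exact Hb| | |].
  - specialize (Heq' 0%nat). rewrite !Hshift in Heq'.
    unfold u, PS_derive in Heq'. simpl in Heq'. lra.
  - specialize (Heq' 1%nat). rewrite !HshiftS, !Hshift in Heq'.
    unfold u, PS_derive in Heq'. simpl in Heq'. fold q. lra.
  - intros n. specialize (Heq' (S (S n))). rewrite !HshiftS in Heq'.
    unfold u, PS_derive in Heq'. fold q. lra.
Qed.

Lemma is_pseries_at_0 (f : nat -> R) (l : R) : is_pseries f 0 l -> f 0%nat = l.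
Proof.
  intros H. apply is_pseries_unique in H. now rewrite PSeries_0 in H.
Qed.

(** Real [t] alone suffice: there the imaginary parts form a power series with sum 0, so they
    vanish, and the real parts are the Taylor coefficients of [exp G]. This serves both polynomial
    families. *)
Lemma real_exp_series (a : nat -> C) (G : R -> R) (c : R) (b : nat -> R) :
  (forall t, Rabs t < 1 ->
     is_pseries (K := C_AbsRing) (V := C_NormedModule) a (RtoC t) (RtoC (exp (G t)))) ->
  G 0 = 0 ->
  (forall t, Rabs t < 1 -> exists g, is_derive G t g /\
     (1 - 2 * c * t + t * t) * g = b 1%nat + (b 2%nat - 2 * c * b 1%nat) * t) ->
  (forall k, b (S (S (S k))) - 2 * c * b (S (S k)) + b (S k) = 0) ->
  (forall n, a n = RtoC (Re (a n))) /\ Re (a 0%nat) = 1 /\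
  log_recurrence b (fun n => Re (a n)).
Proof.
  intros Ha G0 HG Hb.
  assert (HRe : forall t, Rabs t < 1 ->
            is_pseries (fun n => Re (a n)) t (exp (G t))).
  { intros t Ht. exact (proj1 (is_pseries_Re_Im _ _ _ (Ha t Ht))). }
  split; [|split].
  - intros n.
    assert (HIm : Im (a n) = 0).
    { apply (is_pseries_coef_unique (fun n => Im (a n)) (fun _ => 0) (fun _ => 0)).
      - intros t Ht. exact (proj2 (is_pseries_Re_Im _ _ _ (Ha t Ht))).
      - intros t _.
        assert (H := PSeries_correct (fun _ => 0) t
          (CV_radius_inside _ _ ltac:(rewrite CV_radius_const_0; exact I))).
        now rewrite PSeries_const_0 in H. }
    destruct (a n) as [x y]. simpl in *. now rewrite HIm.
  - rewrite <- exp_0, <- G0.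
    apply (is_pseries_at_0 (fun n => Re (a n))), HRe. rewrite Rabs_R0; lra.
  - apply log_recurrence_of_ode with G c; assumption.
Qed.

(** * Growth in [r] of solutions of the recurrence and of their differences *)

Lemma Rabs_le_of_INR_mult (n : nat) (y z : R) :
  INR (S n) * y = z -> Rabs y <= Rabs z.
Proof.
  intros <-. rewrite Rabs_mult, (Rabs_pos_eq (INR (S n))) by apply pos_INR.
  assert (Hy := Rabs_pos y). assert (Hn : 1 <= INR (S n)).
  { rewrite S_INR. pose proof (pos_INR n). lra. }
  nra.
Qed.

(** Strong induction: a term [b (S k) * f (n - k)] costs one factor [r] from [b] and at most [r ^ n]
    from [f]. [K] is fixed before [r], [b] and [f], which is the source of the uniformity in the
    angle. *)
Lemma log_recurrence_bound (M : nat -> R) (n : nat) :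
  exists K, 0 <= K /\
    forall (r : R) (b f : nat -> R), 1 <= r ->
      (forall k, Rabs (b k) <= M k * r) -> f 0%nat = 1 -> log_recurrence b f ->
      forall m, (m <= n)%nat -> Rabs (f m) <= K * r ^ m.
Proof.
  induction n as [|n [K [HK IH]]].
  - exists 1. split; [lra|]. intros r b f Hr _ Hf0 _ m Hm.
    replace m with 0%nat by lia. rewrite Hf0, Rabs_R1. simpl. lra.
  - exists (K + sum_f_R0 (fun k => Rabs (M (S k)) * K) n).
    assert (HS : 0 <= sum_f_R0 (fun k => Rabs (M (S k)) * K) n).
    { apply cond_pos_sum. intros k. apply Rmult_le_pos; [apply Rabs_pos|exact HK]. }
    split; [lra|]. intros r b f Hr Hb Hf0 Hrec m Hm.
    assert (Hpow : 0 <= r ^ m) by (apply pow_le; lra).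
    destruct (Nat.eq_dec m (S n)) as [->|Hne].
    + eapply Rle_trans; [apply (Rabs_le_of_INR_mult n _ _ (Hrec n))|].
      eapply Rle_trans; [apply Rsum_abs|].
      apply Rle_trans with (sum_f_R0 (fun k => Rabs (M (S k)) * K * r ^ S n) n).
      * apply sum_Rle. intros k Hk. rewrite Rabs_mult.
        assert (H1 := Hb (S k)). assert (H2 := IH r b f Hr Hb Hf0 Hrec (n - k)%nat).
        specialize (H2 ltac:(lia)).
        assert (H3 : r ^ (n - k) <= r ^ n) by (apply Rle_pow; [exact Hr|lia]).
        assert (H4 := Rle_abs (M (S k))).
        apply Rle_trans with ((Rabs (M (S k)) * r) * (K * r ^ n)).
        -- apply Rmult_le_compat; try apply Rabs_pos; nra.
        -- simpl. right. ring.
      * rewrite <- scal_sum. nra.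
    + assert (H := IH r b f Hr Hb Hf0 Hrec m ltac:(lia)). nra.
Qed.

(* Only the terms [k >= 3] of the difference [b - b'] survive, and each of them
   costs one power of [r] while consuming at least three indices. *)
Lemma log_recurrence_diff_bound (M : nat -> R) (n : nat) :
  exists K, 0 <= K /\
    forall (r : R) (b b' f f' : nat -> R), 1 <= r ->
      (forall k, Rabs (b k) <= M k * r) -> (forall k, Rabs (b' k) <= M k * r) ->
      b 1%nat = b' 1%nat -> b 2%nat = b' 2%nat ->
      f 0%nat = 1 -> f' 0%nat = 1 ->
      log_recurrence b f -> log_recurrence b' f' ->
      forall m, (m <= n)%nat -> Rabs (f m - f' m) * r ^ 2 <= K * r ^ m.
Proof.
  induction n as [|n [K [HK IH]]].
  - exists 1. split; [lra|].
    intros r b b' f f' Hr _ _ _ _ Hf0 Hf0' _ _ m Hm.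
    replace m with 0%nat by lia. rewrite Hf0, Hf0', Rminus_diag, Rabs_R0. simpl. lra.
  - destruct (log_recurrence_bound M n) as [K' [HK' Hbound]].
    (* [K] in the sum accounts for [f - f'], and [2 * K'] for [b - b'] against [f']; the leading [K]
       preserves the bound at smaller indices. *)
    exists (K + sum_f_R0 (fun k => Rabs (M (S k)) * (K + 2 * K')) n).
    assert (HS : 0 <= sum_f_R0 (fun k => Rabs (M (S k)) * (K + 2 * K')) n).
    { apply cond_pos_sum. intros k. apply Rmult_le_pos; [apply Rabs_pos|lra]. }
    split; [lra|]. intros r b b' f f' Hr Hb Hb' E1 E2 Hf0 Hf0' Hrec Hrec' m Hm.
    assert (Hpow : 0 <= r ^ m) by (apply pow_le; lra).
    destruct (Nat.eq_dec m (S n)) as [->|Hne].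
    (* Splitting [b f - b' f'] as [b (f - f') + (b - b') f']: the first part is handled by
       induction, the second by the growth bound on [f']. *)
    + assert (Hdiff : INR (S n) * (f (S n) - f' (S n))
        = sum_f_R0 (fun k => b (S k) * (f (n - k)%nat - f' (n - k)%nat)
                     + (b (S k) - b' (S k)) * f' (n - k)%nat) n).
      { rewrite Rmult_minus_distr_l, Hrec, Hrec', <- minus_sum.
        apply sum_eq. intros k _. ring. }
      assert (Hr2 : 0 <= r ^ 2) by (apply pow_le; lra).
      eapply Rle_trans.
      { apply Rmult_le_compat_r; [exact Hr2|].
        eapply Rle_trans; [apply (Rabs_le_of_INR_mult n _ _ Hdiff)|apply Rsum_abs]. }
      rewrite Rmult_comm, scal_sum.
      apply Rle_trans with (sum_f_R0 (fun k => Rabs (M (S k)) * (K + 2 * K') * r ^ S n) n).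
      * apply sum_Rle. intros k Hk.
        assert (HA := Rabs_pos (M (S k))).
        assert (HM := Rle_abs (M (S k))).
        assert (H1 : Rabs (b (S k)) <= Rabs (M (S k)) * r)
          by (specialize (Hb (S k)); nra).
        assert (H1' : Rabs (b' (S k)) <= Rabs (M (S k)) * r)
          by (specialize (Hb' (S k)); nra).
        assert (H2 : Rabs (f (n - k)%nat - f' (n - k)%nat) * r ^ 2 <= K * r ^ n).
        { apply Rle_trans with (K * r ^ (n - k)).
          - apply IH with b b'; auto; lia.
          - apply Rmult_le_compat_l; [exact HK|]. apply Rle_pow; [exact Hr|lia]. }
        assert (H3 : Rabs (b (S k) - b' (S k)) * (Rabs (f' (n - k)%nat) * r ^ 2)
                 <= 2 * Rabs (M (S k)) * r * (K' * r ^ n)).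
        { assert (Hpn : 0 <= r ^ n) by (apply pow_le; lra).
          destruct (Nat.le_gt_cases 2 k) as [H2k|Hk2].
          - apply Rmult_le_compat.
            + apply Rabs_pos.
            + apply Rmult_le_pos; [apply Rabs_pos|exact Hr2].
            + eapply Rle_trans; [apply Rabs_triang|]. rewrite Rabs_Ropp. lra.
            + apply Rle_trans with (K' * r ^ (n - k) * r ^ 2).
              * apply Rmult_le_compat_r; [exact Hr2|].
                apply Hbound with b'; auto; lia.
              * rewrite Rmult_assoc, <- pow_add.
                apply Rmult_le_compat_l; [exact HK'|]. apply Rle_pow; [exact Hr|lia].
          - replace (b (S k) - b' (S k)) with 0.
            + rewrite Rabs_R0, Rmult_0_l.
              repeat apply Rmult_le_pos; try assumption; lra.
            + destruct k as [|[|k]]; [lra|lra|lia]. }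
        eapply Rle_trans.
        { apply Rmult_le_compat_r; [exact Hr2|]. apply Rabs_triang. }
        rewrite !Rabs_mult, Rmult_plus_distr_r, !Rmult_assoc.
        assert (H4 : Rabs (b (S k)) * (Rabs (f (n - k)%nat - f' (n - k)%nat) * r ^ 2)
                 <= Rabs (M (S k)) * r * (K * r ^ n)).
        { apply Rmult_le_compat; [apply Rabs_pos| |exact H1|exact H2].
          apply Rmult_le_pos; [apply Rabs_pos|exact Hr2]. }
        change (r ^ S n) with (r * r ^ n). lra.
      * rewrite <- scal_sum. nra.
    + assert (H : Rabs (f m - f' m) * r ^ 2 <= K * r ^ m)
        by (apply IH with b b'; auto; lia). nra.
Qed.

(** * Logarithmic coefficients of the two families *)

Definition logcoef_MP (phi x lambda : R) (k : nat) : R :=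
  2 * (lambda * cos (INR k * phi) + x * sin (INR k * phi)).

Definition logcoef_Laguerre (alpha x : R) (k : nat) : R := alpha + 1 - INR k * x.

Lemma logcoef_MP_rec (phi x lambda : R) (k : nat) :
  logcoef_MP phi x lambda (S (S (S k)))
  - 2 * cos phi * logcoef_MP phi x lambda (S (S k)) + logcoef_MP phi x lambda (S k) = 0.
Proof.
  unfold logcoef_MP. rewrite !S_INR. set (a := (INR k + 1 + 1) * phi).
  replace ((INR k + 1 + 1 + 1) * phi) with (a + phi) by (unfold a; ring).
  replace ((INR k + 1) * phi) with (a - phi) by (unfold a; ring).
  rewrite cos_plus, cos_minus, sin_plus, sin_minus. ring.
Qed.

Lemma logcoef_MP_1 (phi x lambda : R) :
  logcoef_MP phi x lambda 1 = 2 * (lambda * cos phi + x * sin phi).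
Proof. unfold logcoef_MP. simpl. now rewrite Rmult_1_l. Qed.

Lemma logcoef_MP_2 (phi x lambda : R) :
  logcoef_MP phi x lambda 2 = 2 * (lambda * cos (2 * phi) + x * sin (2 * phi)).
Proof. unfold logcoef_MP. simpl. reflexivity. Qed.

(** With [b_k] the Meixner-Pollaczek coefficients, [A = b_1 - b_2] and [C + 1 = 2 b_1 - b_2]; this
    is the solution of [C + 1 - A = b_1], [C + 1 - 2 A = b_2]. *)
Lemma logcoef_eq_1 (phi x lambda : R) :
  logcoef_MP phi x lambda 1
  = logcoef_Laguerre (coefC phi x lambda) (coefA phi x lambda) 1.
Proof.
  rewrite logcoef_MP_1. unfold logcoef_Laguerre, coefC, coefA. simpl. ring.
Qed.

Lemma logcoef_eq_2 (phi x lambda : R) :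
  logcoef_MP phi x lambda 2
  = logcoef_Laguerre (coefC phi x lambda) (coefA phi x lambda) 2.
Proof.
  rewrite logcoef_MP_2. unfold logcoef_Laguerre, coefC, coefA. simpl. ring.
Qed.

Lemma lin_comb_bound (x y r u v A B : R) :
  Rabs x <= r -> Rabs y <= r -> Rabs u <= A -> Rabs v <= B ->
  Rabs (x * u + y * v) <= r * (A + B).
Proof.
  intros Hx Hy Hu Hv. eapply Rle_trans; [apply Rabs_triang|].
  rewrite !Rabs_mult, Rmult_plus_distr_l.
  apply Rplus_le_compat; apply Rmult_le_compat; auto using Rabs_pos.
Qed.

Lemma logcoef_MP_bound (phi x lambda r : R) (k : nat) :
  Rabs x <= r -> Rabs lambda <= r ->
  Rabs (logcoef_MP phi x lambda k) <= (12 + 8 * INR k) * r.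
Proof.
  intros Hx Hl. unfold logcoef_MP.
  assert (H := lin_comb_bound _ _ _ _ _ 1 1 Hl Hx
     (Rabs_le _ _ (COS_bound (INR k * phi)))
     (Rabs_le _ _ (SIN_bound (INR k * phi)))).
  assert (Hk := pos_INR k). assert (Hr := Rle_trans _ _ _ (Rabs_pos x) Hx).
  rewrite Rabs_mult, (Rabs_pos_eq 2) by lra. nra.
Qed.

(** The [-1] in [coefC] cancels the [+1] of the coefficient, leaving a form linear in [x] and
    [lambda]. The terms are at most [2 * 6 r] and [2 * 4 r * INR k], whence [12 + 8 * INR k]. *)
Lemma logcoef_Laguerre_bound (phi x lambda r : R) (k : nat) :
  Rabs x <= r -> Rabs lambda <= r ->
  Rabs (logcoef_Laguerre (coefC phi x lambda) (coefA phi x lambda) k)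
    <= (12 + 8 * INR k) * r.
Proof.
  intros Hx Hl. unfold logcoef_Laguerre, coefC, coefA.
  pose proof (COS_bound phi). pose proof (SIN_bound phi).
  pose proof (COS_bound (2 * phi)). pose proof (SIN_bound (2 * phi)).
  assert (HC := lin_comb_bound _ _ _ (2 * sin phi - sin (2 * phi))
     (2 * cos phi - cos (2 * phi)) 3 3 Hx Hl
     ltac:(apply Rabs_le; lra) ltac:(apply Rabs_le; lra)).
  assert (HA := lin_comb_bound _ _ _ (sin phi - sin (2 * phi))
     (cos phi - cos (2 * phi)) 2 2 Hx Hl
     ltac:(apply Rabs_le; lra) ltac:(apply Rabs_le; lra)).
  assert (Hk := pos_INR k).
  match type of HC with Rabs ?u <= _ => set (C0 := u) in * end.
  match type of HA with Rabs ?u <= _ => set (A0 := u) in * end.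
  replace (2 * C0 - 1 + 1 - INR k * (2 * A0)) with (2 * C0 + - (INR k * (2 * A0))) by ring.
  eapply Rle_trans; [apply Rabs_triang|].
  rewrite Rabs_Ropp, !Rabs_mult, (Rabs_pos_eq 2), (Rabs_pos_eq (INR k)) by lra.
  nra.
Qed.

(** * Real logarithms of the generating functions and their differential equations *)

Definition log_MP_gen (phi x lambda t : R) : R :=
  - 2 * lambda * ln (sqrt ((1 - cos phi * t) ^ 2 + (sin phi * t) ^ 2))
  + 2 * x * atan (sin phi * t / (1 - cos phi * t)).

(** For real [t] the two factors are complex conjugates, so the phases cancel and the product is the
    exponential of twice the common real part [- lambda * l + x * th]. *)
Lemma MP_gen_RtoC (phi x lambda t : R) :
  MP_gen lambda x phi (RtoC t) = RtoC (exp (log_MP_gen phi x lambda t)).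
Proof.
  set (c := cos phi). set (s := sin phi).
  set (l := ln (sqrt ((1 - c * t) ^ 2 + (s * t) ^ 2))).
  set (th := atan (s * t / (1 - c * t))).
  assert (H1 : Cln (1 - Cexp (Ci * phi) * t) = (l, - th)).
  { replace (1 - Cexp (Ci * phi) * t)%C with ((1 - c * t, - (s * t)) : C).
    - unfold Cln, l, th, Cmod. simpl. f_equal.
      + do 2 f_equal. ring.
      + rewrite <- atan_opp. f_equal. unfold Rdiv. ring.
    - unfold Cexp, Cminus, Cplus, Copp, Cmult, RtoC, Re, Im, Ci. simpl.
      replace (0 * phi - 1 * 0) with 0 by ring.
      replace (0 * 0 + 1 * phi) with phi by ring.
      rewrite exp_0. unfold c, s. f_equal; ring. }
  assert (H2 : Cln (1 - Cexp (- (Ci * phi)) * t) = (l, th)).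
  { replace (1 - Cexp (- (Ci * phi)) * t)%C with ((1 - c * t, s * t) : C).
    - unfold Cln, l, th, Cmod. reflexivity.
    - unfold Cexp, Cminus, Cplus, Copp, Cmult, RtoC, Re, Im, Ci. simpl.
      replace (- (0 * phi - 1 * 0)) with 0 by ring.
      replace (- (0 * 0 + 1 * phi)) with (- phi) by ring.
      rewrite exp_0, cos_neg, sin_neg. unfold c, s. f_equal; ring. }
  unfold MP_gen, Cpower. rewrite H1, H2.
  unfold Cexp, Cminus, Cplus, Copp, Cmult, RtoC, Re, Im, Ci, log_MP_gen.
  fold c s l th. simpl.
  match goal with |- (exp ?u * cos ?v * (exp ?u' * cos ?v') - _, _) = _ =>
    replace v' with (- v) by ring;
    replace (- 2 * lambda * l + 2 * x * th) with (u + u') by ring;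
    generalize u u' v end.
  intros u u' v. rewrite cos_neg, sin_neg, exp_plus.
  pose proof (sin2_cos2 v) as Hsc. unfold Rsqr in Hsc.
  f_equal.
  - transitivity (exp u * exp u' * (sin v * sin v + cos v * cos v)); [ring|].
    rewrite Hsc. ring.
  - ring.
Qed.

Lemma Rabs_mult_le_l (r u : R) : 0 <= r -> Rabs u <= 1 -> Rabs (r * u) <= r.
Proof.
  intros Hr Hu. rewrite Rabs_mult, (Rabs_pos_eq r) by exact Hr. nra.
Qed.

Lemma one_sub_cos_mult_pos (phi t : R) : Rabs t < 1 -> 0 < 1 - cos phi * t.
Proof.
  intros Ht. rewrite (Rmult_comm (cos phi)).
  assert (H := Rabs_mult_le_l _ _ (Rabs_pos t) (Rabs_le _ _ (COS_bound phi))).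
  assert (H' := Rle_abs (t * cos phi)).
  rewrite Rabs_mult in H, H'. rewrite Rabs_Rabsolu in H. lra.
Qed.

Lemma log_MP_gen_ode (phi x lambda t : R) : Rabs t < 1 ->
  exists g, is_derive (log_MP_gen phi x lambda) t g /\
    (1 - 2 * cos phi * t + t * t) * g
    = logcoef_MP phi x lambda 1
      + (logcoef_MP phi x lambda 2 - 2 * cos phi * logcoef_MP phi x lambda 1) * t.
Proof.
  intros Ht. assert (Hre := one_sub_cos_mult_pos phi t Ht).
  rewrite logcoef_MP_1, logcoef_MP_2, cos_2a, sin_2a.
  pose proof (sin2_cos2 phi) as Hsc. unfold Rsqr in Hsc.
  set (c := cos phi) in *. set (s := sin phi) in *.
  assert (HD : (1 - c * t) ^ 2 + (s * t) ^ 2 = 1 - 2 * c * t + t * t).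
  { transitivity (1 - 2 * c * t + (s * s + c * c) * (t * t)); [ring|].
    rewrite Hsc; ring. }
  assert (HDpos : 0 < (1 - c * t) ^ 2 + (s * t) ^ 2) by nra.
  (* With [D = (1 - c t)^2 + (s t)^2], the derivative of [ln (sqrt D)] is [(t - c) / D] and that of
     the arctangent is [s / D]. *)
  exists (- 2 * lambda * ((t - c) / ((1 - c * t) ^ 2 + (s * t) ^ 2))
     + 2 * x * (s / ((1 - c * t) ^ 2 + (s * t) ^ 2))).
  split.
  - unfold log_MP_gen. fold c s.
    assert (Hsq : 0 < sqrt ((1 - c * t) ^ 2 + (s * t) ^ 2)) by now apply sqrt_lt_R0.
    set (d := (1 - c * t) ^ 2 + (s * t) ^ 2) in *.
    auto_derive;
      replace ((1 + - (c * t)) * ((1 + - (c * t)) * 1) + s * t * (s * t * 1))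
        with d by (unfold d; ring).
    + repeat split; try assumption; lra.
    + assert (HS := sqrt_sqrt _ (Rlt_le _ _ HDpos)). f_equal.
      * replace (t - c) with ((s * s + c * c) * t - c) by (rewrite Hsc; ring).
        (* Writing [d] as the square of [sqrt d] leaves [field] with [sqrt d] as the only atom for
           it. *)
        rewrite <- HS at 3. field. lra.
      * f_equal. unfold d. field. fold d. split; [|lra].
        intros E. apply (Rgt_not_eq _ _ HDpos). unfold d. lra.
  - rewrite <- HD. 
    transitivity (- 2 * lambda * (t - c) + 2 * x * s); [field; lra|].
    replace (s * s) with (1 - c * c) by lra. ring.
Qed.

Definition log_Laguerre_gen (alpha x t : R) : R :=
  (- alpha - 1) * ln (1 - t) - t * x / (1 - t).

Lemma Laguerre_gen_RtoC (alpha x t : R) : Rabs t < 1 ->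
  Laguerre_gen (RtoC alpha) (RtoC x) (RtoC t)
  = RtoC (exp (log_Laguerre_gen alpha x t)).
Proof.
  intros Ht. apply Rabs_def2 in Ht.
  assert (Hne : 1 - t <> 0) by lra.
  assert (Hexp : forall y : R, Cexp (RtoC y) = RtoC (exp y)).
  { intros y. unfold Cexp, RtoC. simpl. rewrite cos_0, sin_0. f_equal; ring. }
  unfold Laguerre_gen, Cpower.
  rewrite <- RtoC_minus.
  replace (Cln (RtoC (1 - t))) with (RtoC (ln (1 - t))).
  - rewrite <- RtoC_opp, <- RtoC_minus, <- !RtoC_mult, <- RtoC_opp, <- RtoC_div by exact Hne.
    rewrite !Hexp, <- RtoC_mult, <- exp_plus. unfold log_Laguerre_gen.
    do 2 f_equal. field. exact Hne.
  - unfold Cln. rewrite Cmod_R, Rabs_pos_eq by lra. simpl.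
    unfold Rdiv. rewrite Rmult_0_l, atan_0. reflexivity.
Qed.

(** Here [c = 1], so the quadratic factor is [(1 - t)^2] and clears the double pole of the
    derivative at 1. *)
Lemma log_Laguerre_gen_ode (alpha x t : R) : Rabs t < 1 ->
  exists g, is_derive (log_Laguerre_gen alpha x) t g /\
    (1 - 2 * 1 * t + t * t) * g
    = logcoef_Laguerre alpha x 1
      + (logcoef_Laguerre alpha x 2 - 2 * 1 * logcoef_Laguerre alpha x 1) * t.
Proof.
  intros Ht. apply Rabs_def2 in Ht.
  exists ((alpha + 1) / (1 - t) - x / (1 - t) ^ 2). split.
  - unfold log_Laguerre_gen. auto_derive; [repeat split; lra|]. field. lra.
  - unfold logcoef_Laguerre. simpl. field. lra.
Qed.

(** * Comparison of the two families, uniformly in the angle *)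

Theorem mainTheorem2
  (P : nat -> R -> R -> R -> C) (L : nat -> C -> C -> C)
  (hP : is_Meixner_Pollaczek P) (hL : is_Laguerre L)
  (n : nat) (phi : R) :
  exists K r0 : R, 0 < r0 /\
    forall r theta : R, r0 <= r -> 0 <= theta <= PI ->
      let x := r * cos theta in
      let lambda := r * sin theta in
      Cmod (P n lambda x phi
            - L n (RtoC (coefC phi x lambda)) (RtoC (coefA phi x lambda)))%C
        <= K * powerRZ r (Z.of_nat n - 2).
Proof.
  destruct (log_recurrence_diff_bound (fun k => 12 + 8 * INR k) n) as [K [HK Hbound]].
  (* The recurrence bounds hold as soon as [1 <= r], and [K] depends only on [n]. *)
  exists K, 1. split; [lra|]. intros r theta Hr _ x lambda.
  assert (Hx : Rabs x <= r).
  { apply Rabs_mult_le_l; [lra|apply Rabs_le, COS_bound]. }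
  assert (Hl : Rabs lambda <= r).
  { apply Rabs_mult_le_l; [lra|apply Rabs_le, SIN_bound]. }
  set (alpha := coefC phi x lambda). set (X := coefA phi x lambda).
  destruct (real_exp_series (fun m => P m lambda x phi) (log_MP_gen phi x lambda)
    (cos phi) (logcoef_MP phi x lambda)) as [HP [HP0 HPrec]].
  { intros t Ht. rewrite <- MP_gen_RtoC. apply hP. now rewrite Cmod_R. }
  { unfold log_MP_gen, Rdiv.
    rewrite !Rmult_0_r, Rmult_0_l, atan_0, Rminus_0_r.
    replace (1 ^ 2 + 0 ^ 2) with 1 by ring. rewrite sqrt_1, ln_1. ring. }
  { apply log_MP_gen_ode. }
  { apply logcoef_MP_rec. }
  destruct (real_exp_series (fun m => L m (RtoC alpha) (RtoC X))
    (log_Laguerre_gen alpha X) 1 (logcoef_Laguerre alpha X)) as [HL [HL0 HLrec]].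
  { intros t Ht. rewrite <- Laguerre_gen_RtoC by exact Ht. apply hL. now rewrite Cmod_R. }
  { unfold log_Laguerre_gen. rewrite Rminus_0_r, ln_1. field. }
  { apply log_Laguerre_gen_ode. }
  { intros k. unfold logcoef_Laguerre. rewrite !S_INR. ring. }
  assert (H := Hbound r _ _ _ _ Hr
    (fun k => logcoef_MP_bound phi x lambda r k Hx Hl)
    (fun k => logcoef_Laguerre_bound phi x lambda r k Hx Hl)
    (logcoef_eq_1 phi x lambda) (logcoef_eq_2 phi x lambda)
    HP0 HL0 HPrec HLrec n (Nat.le_refl n)).
  rewrite (HP n), (HL n), <- RtoC_minus, Cmod_R.
  assert (Hr2 : 0 < r ^ 2) by (apply pow_lt; lra).
  (* The difference bound carries the factor [r ^ 2] on the left; dividing it out yields the integer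
     power [n - 2], negative when [n < 2]. *)
  apply Rmult_le_reg_r with (r ^ 2); [exact Hr2|].
  eapply Rle_trans; [exact H|].
  change (Z.of_nat n - 2)%Z with (Z.of_nat n + - Z.of_nat 2)%Z.
  rewrite powerRZ_add by lra. rewrite powerRZ_neg', <- !pow_powerRZ.
  right. field. lra.
Qed.
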